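(* Let $\ell\geq 2$ and $r\geq 2$ be integers. Let $\mathcal{N}_{4\ell,\leq r}^{\operatorname{hom}}\subseteq\mathbb{R}^{(\ell-1)(r-1)}$ be the closure of the set of points $$\left(\frac{\operatorname{hom}(N_{8,2};G)}{\operatorname{hom}(N_{4,2};G)^2}, \ldots, \frac{\operatorname{hom}(N_{4\ell,2};G)}{\operatorname{hom}(N_{4,2};G)^\ell},\ \frac{\operatorname{hom}(N_{8,3};G)}{\operatorname{hom}(N_{4,3};G)^2}, \ldots, \frac{\operatorname{hom}(N_{4\ell,3};G)}{\operatorname{hom}(N_{4,3};G)^\ell},\ \ldots,\ \frac{\operatorname{hom}(N_{8,r};G)}{\operatorname{hom}(N_{4,r};G)^2}, \ldots, \frac{\operatorname{hom}(N_{4\ell,r};G)}{\operatorname{hom}(N_{4,r};G)^\ell}\right)$$ (i.e. the block for $q=2$, then $q=3$, ..., then $q=r$, each block consisting of the ratios $\operatorname{hom}(N_{4j,q};G)/\operatorname{hom}(N_{4,q};G)^j$ for $j=2,\ldots,\ell$), over all graphs $G$ such that $\operatorname{hom}(N_{4,q};G)\neq 0$ for every $2\leq q\leq r$. Then $\mathcal{N}_{4\ell,\leq r}^{\operatorname{hom}}=\Pi_\ell^{r-1}$, the direct product of $r-1$ copies of $\Pi_\ell$.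
   Context: Graphs are finite simple graphs. For graphs $H,G$, $\operatorname{hom}(H;G)$ is the number of maps $V(H)\to V(G)$ sending every edge of $H$ to an edge of $G$. For a graph $F$ and an integer $q\geq 3$, the $q$-ification of $F$ is the graph obtained from $F$ by adding, for every edge $\{u,v\}$ of $F$, $q-2$ new vertices which are pairwise adjacent and adjacent to both $u$ and $v$ (so each edge of $F$ is replaced by a clique of size $q$); the $2$-ification of $F$ is $F$ itself. The $q$-necklace $N_{c,q}$ is the $q$-ification of the cycle $C_c$ of length $c$. For $\mathbf{x}\in\mathbb{R}^n$ and $i\in\mathbb{N}$, $p_i(\mathbf{x})=\sum_{j=1}^n x_j^i$. Let $\Pi_{n,\ell}=\{(p_2(\mathbf{x}),\ldots,p_\ell(\mathbf{x})) : \mathbf{x}\in\mathbb{R}^n_{\geq 0},\ p_1(\mathbf{x})=1\}$ and the power-sum profile $\Pi_\ell=\operatorname{cl}\left(\bigcup_{n\in\mathbb{N}}\Pi_{n,\ell}\right)\subseteq\mathbb{R}^{\ell-1}$, where $\operatorname{cl}$ is topological closure. *)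

(* Defs.v *)
From HB Require Import structures.
From mathcomp Require Import all_boot all_order all_algebra.
From mathcomp Require Import all_classical all_reals all_analysis.
Set Implicit Arguments.
Unset Strict Implicit.
Unset Printing Implicit Defensive.
Import Order.TTheory GRing.Theory Num.Theory.
Import numFieldNormedType.Exports.

Record sgraph := SGraph {
  vertex :> finType;
  adj : rel vertex;
  adj_sym : symmetric adj;
  adj_irr : irreflexive adj }.

Definition hom_count (H G : sgraph) : nat :=
  #|[set f : {ffun H -> G}
      | [forall u, forall v, adj u v ==> adj (f u) (f v)]]|.

Section Cycle.
Variable c : nat.

(* The first conjunct only matters for the degenerate case c = 1. *)
Definition cycle_adj (i j : 'I_c) : bool :=
  (i != j) && ((j == ordS i) || (i == ordS j)).

Lemma cycle_adj_sym : symmetric cycle_adj.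
Proof. by move=> i j; rewrite /cycle_adj eq_sym orbC. Qed.

Lemma cycle_adj_irr : irreflexive cycle_adj.
Proof. by move=> i; rewrite /cycle_adj eqxx. Qed.

Definition cycle_graph : sgraph := SGraph cycle_adj_sym cycle_adj_irr.
End Cycle.

Section Qification.
Variables (F : sgraph) (q : nat).

Definition edges : {set {set F}} :=
  [set e | [exists u, exists v, adj u v && (e == [set u; v])]].

(* Each edge e of F receives q - 2 new vertices (e, 0), ..., (e, q - 3);
   for q = 2 there are none and the graph is F (with vertices tagged inl). *)
Definition qif_vertex : finType := (F + {e | e \in edges} * 'I_(q - 2))%type.

Definition qif_adj (x y : qif_vertex) : bool :=
  match x, y with
  | inl u, inl v => adj u v
  | inl u, inr (e, _) => u \in val e
  | inr (e, _), inl v => v \in val e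
  | inr (e, i), inr (e', j) => (e == e') && (i != j)
  end.

Lemma qif_adj_sym : symmetric qif_adj.
Proof.
case=> [u|[e i]] [v|[e' j]] //=; first exact: adj_sym.
by rewrite eq_sym [i == j]eq_sym.
Qed.

Lemma qif_adj_irr : irreflexive qif_adj.
Proof. by case=> [u|[e i]] /=; rewrite ?adj_irr ?eqxx. Qed.

Definition qification : sgraph := SGraph qif_adj_sym qif_adj_irr.
End Qification.

Definition necklace (c q : nat) : sgraph := qification (cycle_graph c) q.

Section Profiles.
Local Open Scope classical_set_scope.
Local Open Scope ring_scope.
Variable R : realType.

Definition power_sum (n : nat) (x : 'rV[R]_n) (i : nat) : R :=
  \sum_(j < n) x 0 j ^+ i.

(* Column k of a point holds p_(k+2), for k = 0, ..., l - 2. *)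
Definition power_sum_points (n l : nat) : set 'rV[R]_(l - 1) :=
  [set y | exists x : 'rV[R]_n,
     [/\ forall j, 0 <= x 0 j, power_sum x 1 = 1
       & y = \row_(k < l - 1) power_sum x (k + 2)]].

Definition power_sum_profile (l : nat) : set 'rV[R]_(l - 1) :=
  closure (\bigcup_(n in [set: nat]) @power_sum_points n l).

(* R^((l-1)(r-1)) is represented by (r-1) x (l-1) matrices, with the product
   topology: row i is the block of q = i + 2, and its column k is the
   coordinate of index j = k + 2. *)
Definition necklace_point (l r : nat) (G : sgraph) : 'M[R]_(r - 1, l - 1) :=
  \matrix_(i < r - 1, k < l - 1)
    ((hom_count (necklace (4 * (k + 2)) (i + 2)) G)%:R /
     (hom_count (necklace 4 (i + 2)) G)%:R ^+ (k + 2)).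

Definition necklace_profile (l r : nat) : set 'M[R]_(r - 1, l - 1) :=
  closure [set M | exists G : sgraph,
    (forall q, (2 <= q <= r)%N -> hom_count (necklace 4 q) G <> 0%N) /\
    M = @necklace_point l r G].

Definition profile_power (m n : nat) (A : set 'rV[R]_n) : set 'M[R]_(m, n) :=
  [set M | forall i, A (row i M)].
End Profiles.

Arguments necklace_profile R l r : clear implicits.
Arguments power_sum_profile R l : clear implicits.
Arguments necklace_point R l r G : clear implicits.
Arguments profile_power {R} m {n} A.

(* Main.v *)
(** Write [M_q] for the symmetric matrix over [V(G)] whose entry at [(a, b)] is the
    number of ways to extend the edge [ab] to an ordered [q]-clique.  Then
    [hom(N_(c,q); G) = tr(M_q^c)], the sum of the [c]-th powers of the real
    eigenvalues of [M_q]; normalising the fourth powers of the eigenvalues shows that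
    every row of a necklace point is a point of [Pi_l].

    Conversely, [tower N p b] behaves like a random graph of density [1/p] on
    [n = N p^N b] vertices: [hom(F; tower N p b)] is [n^v(F) p^(-e(F))] up to a factor
    tending to 1 as [N] grows.  For [F = N_(4j,q)] this is [X^v] with [v = 4j(q-1)] and
    [X = n p^(-q/2)].  Take the disjoint union of towers with [p = P^(4(r-q'))] and
    [n] proportional to [P^(-q'^2) m_(q',x)], for [2 <= q' <= r]: then [X] is
    proportional to [m_(q',x) P^(-(q-q')^2)], so that as [P] grows only the block
    [q' = q] is visible to [N_(4j,q)], and the [q]-th block of coordinates
    tends to the normalised power sums of the numbers [m_(q,x)^(4(q-1))].  These are
    dense in [Pi_l], independently for each [q]. *)

Require Import Defs.
From HB Require Import structures.
From mathcomp Require Import all_boot all_order all_algebra.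
From mathcomp Require Import all_classical all_reals all_analysis.
From mathcomp Require Import spectral complex zify ring lra.
Set Implicit Arguments.
Unset Strict Implicit.
Unset Printing Implicit Defensive.
Import Order.TTheory GRing.Theory Num.Theory.
Import numFieldNormedType.Exports.

Local Open Scope nat_scope.

(** * Homomorphism counts as sums of indicators *)

Lemma hom_countE (F G : sgraph) : hom_count F G =
  \sum_(f : {ffun F -> G}) [forall u, forall v, adj u v ==> adj (f u) (f v)].
Proof.
by rewrite -big_mkcond sum1dep_card /hom_count; apply: eq_card => f; rewrite !inE.
Qed.

Lemma prod_nat_bool (I : finType) (b : I -> bool) :
  \prod_i (b i : nat) = [forall i, b i].
Proof.
have [/forallP h|/forallPn[i /negbTE bi]] := boolP [forall i, b i].
  by rewrite big1 // => i _; rewrite h.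
by rewrite (bigD1 i) //= bi.
Qed.

Lemma sum_pair (A B : finType) (f : A * B -> nat) :
  \sum_p f p = \sum_a \sum_b f (a, b).
Proof. by rewrite pair_bigA; apply: eq_bigr => -[]. Qed.

(** Abstract degree sum of a [q]-ification, with [E] for the edges and [K] for the new vertices on
    each edge. The three terms are the pairs of old vertices, the mixed pairs in both orders, and
    the pairs of distinct new vertices on one edge. *)
Lemma sum_sum_type_adj (V E K : finType) (A : rel V) (inc : V -> E -> bool) :
  \sum_(x : V + E * K) \sum_(y : V + E * K)
    match x, y return bool with
    | inl u, inl v => A u v
    | inl u, inr (e, _) => inc u e
    | inr (e, _), inl v => inc v e
    | inr (e, i), inr (e', j) => (e == e') && (i != j)
    end =
  \sum_u \sum_v A u v + 2 * #|K| * (\sum_e \sum_u inc u e)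
  + #|E| * (#|K| * (#|K| - 1)).
Proof.
rewrite big_sumType /=.
under eq_bigr do rewrite big_sumType /=.
under [X in _ + X]eq_bigr do rewrite big_sumType /=.
rewrite !big_split /=.
have ends : \sum_(x : E * K) \sum_u nat_of_bool (let (e, _) := x in inc u e) =
    #|K| * (\sum_e \sum_u inc u e).
  rewrite sum_pair big_distrr /=; apply: eq_bigr => e _.
  by rewrite sum_nat_const.
rewrite [X in _ + X + _]exchange_big /= !ends.
have -> : \sum_(x : E * K) \sum_(y : E * K)
    nat_of_bool (let (e, i) := x in let (e', j) := y in (e == e') && (i != j)) =
    #|E| * (#|K| * (#|K| - 1)).
  rewrite sum_pair (eq_bigr (fun=> #|K| * (#|K| - 1))) ?sum_nat_const // => e _.
  rewrite (eq_bigr (fun=> #|K| - 1)) ?sum_nat_const // => i _.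
  rewrite sum_pair (bigD1 e) //= [X in _ + X]big1 ?addn0.
    under eq_bigr do rewrite eqxx eq_sym.
    by rewrite -big_mkcond sum1_card subn1 -(cardC1 i).
  by move=> e' /negbTE ne; rewrite big1 // => j _; rewrite eq_sym ne.
by rewrite -[2 * _ * _]mulnA mul2n -addnn !addnA.
Qed.

(** * Size, degree sum and connectedness of necklaces *)

Definition adj_pairs (F : sgraph) : nat := \sum_(u : F) \sum_(v : F) adj u v.

Section NecklaceStructure.
Variable c : nat.
Hypothesis c_gt2 : 2 < c.

Lemma ordS_neq (i : 'I_c) : i != ordS i.
Proof.
apply/eqP => /(congr1 val) /= h; case: i h => i /= ic h.
have [E|ne] := eqVneq i.+1 c; first by rewrite E modnn in h; lia.
by rewrite modn_small in h; lia.
Qed.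

Lemma ordS_ordS_neq (i : 'I_c) : ordS (ordS i) != i.
Proof.
apply/eqP => /(congr1 val) /=; case: i => i /= ic.
have [E|ne] := eqVneq i.+1 c; first by rewrite E modnn modn_small; lia.
rewrite [i.+1 %% c]modn_small; last by lia.
have [E|ne2] := eqVneq i.+2 c; first by rewrite E modnn; lia.
by rewrite modn_small; lia.
Qed.

Lemma cyc_edge_subproof (i : 'I_c) : [set i; ordS i] \in edges (cycle_graph c).
Proof.
rewrite inE; apply/existsP; exists i; apply/existsP; exists (ordS i).
by rewrite eqxx andbT /= /cycle_adj ordS_neq eqxx.
Qed.

Definition cyc_edge (i : 'I_c) : {e | e \in edges (cycle_graph c)} :=
  exist _ [set i; ordS i] (cyc_edge_subproof i).

(** Injectivity uses [2 < c]: if [{i, i+1} = {j, j+1}] with [i <> j], then [i = j+1], so that [j+2]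
    lies in [{j, j+1}], which is impossible. *)
Lemma cyc_edge_bij : bijective cyc_edge.
Proof.
apply: inj_card_bij.
  move=> i j /(congr1 val) /= E.
  have: i \in [set j; ordS j] by rewrite -E set21.
  rewrite !inE => /orP[/eqP//|/eqP iE].
  have: ordS i \in [set j; ordS j] by rewrite -E set22.
  rewrite iE !inE => /orP[|]; first by rewrite (negbTE (ordS_ordS_neq _)).
  by rewrite eq_sym (negbTE (ordS_neq _)).
suff sub : {: {e | e \in edges (cycle_graph c)}} \subset codom cyc_edge.
  apply: leq_trans (subset_leq_card sub) _.
  exact: leq_image_card.
apply/fintype.subsetP => -[e he] _; have := he; rewrite {1}inE => /existsP[u /existsP[v]].
move=> /andP[/andP[uv /orP[/eqP E|/eqP E]] /eqP eE]; apply/codomP.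
  by exists u; apply: val_inj; rewrite /= eE E.
by exists v; apply: val_inj; rewrite /= eE E finset.setUC.
Qed.

Lemma mem_cyc_edge (i j : 'I_c) :
  (j \in val (cyc_edge i)) = (j == i) || (j == ordS i).
Proof. by rewrite !inE. Qed.

Lemma card_cyc_edges : #|{: {e | e \in edges (cycle_graph c)}}| = c.
Proof. by rewrite -(bij_eq_card cyc_edge_bij) card_ord. Qed.

Lemma card_necklace q : 2 <= q -> #|necklace c q| = c * (q - 1).
Proof.
move=> hq; rewrite card_sum card_prod card_cyc_edges !card_ord.
by case: q hq => [|[|q]] // _; rewrite !subSS !subn0 mulnS.
Qed.

Lemma cycle_deg (i : 'I_c) : \sum_(j < c) cycle_adj i j = 2.
Proof.
rewrite -big_mkcond sum1dep_card.
have -> : [set j | cycle_adj i j] = [set ordS i; ord_pred i].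
  apply/finset.setP => j; rewrite !inE /cycle_adj.
  have -> : (i == ordS j) = (j == ord_pred i).
    by apply/eqP/eqP => ->; rewrite ?ordSK ?ord_predK.
  apply: andb_idl => /orP[] /eqP ->; first exact: ordS_neq.
  by have := ordS_neq (ord_pred i); rewrite ord_predK eq_sym.
rewrite cards2; congr _.+1; apply/eqP; rewrite eqb1; apply/eqP => E.
by have /eqP[] := ordS_ordS_neq i; rewrite E ord_predK.
Qed.

Lemma sum_cyc_edges (f : {e | e \in edges (cycle_graph c)} -> nat) :
  \sum_e f e = \sum_(i < c) f (cyc_edge i).
Proof. by rewrite (reindex cyc_edge) //; apply: onW_bij cyc_edge_bij. Qed.

Lemma adj_pairs_necklace q : 2 <= q -> adj_pairs (necklace c q) = c * (q - 1) * q.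
Proof.
move=> hq; rewrite /adj_pairs; etransitivity.
  exact: (@sum_sum_type_adj _ {e | e \in edges (cycle_graph c)} 'I_(q - 2)
    (@cycle_adj c) (fun i e => i \in val e)).
rewrite (eq_bigr _ (fun i _ => cycle_deg i)) sum_nat_const card_cyc_edges !card_ord.
rewrite sum_cyc_edges (eq_bigr (fun=> 2)); last first.
  by move=> i _; rewrite -big_mkcond sum1_card cards2 ordS_neq.
rewrite sum_nat_const card_ord.
(* Per edge of the cycle, [2 + 4(q-2) + (q-2)(q-3) = (q-1)q]; small [q] are split off because of
   truncated subtraction. *)
by case: q hq => [|[|[|q]]] //= _; lia.
Qed.

(** Connectedness makes necklace counts additive over disjoint unions, through [hom_dunion]. *)
Lemma necklace_connected q (x y : necklace c q) : connect (@adj _) x y.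
Proof.
have csym : connect_sym (@adj (necklace c q)) by apply/sym_connect_sym/adj_sym.
have zc : 0 < c by lia.
have cyc (i : 'I_c) : connect (@adj (necklace c q)) (inl (Ordinal zc)) (inl i).
  case: i => i ic; elim: i ic => [|i IH] ic.
    by rewrite (_ : Ordinal zc = Ordinal ic) //; apply: val_inj.
  apply: connect_trans (IH (ltnW ic)) (connect1 _).
  have E : Ordinal ic = ordS (Ordinal (ltnW ic)).
    by apply: val_inj; rewrite /= modn_small.
  by rewrite /= /cycle_adj E ordS_neq eqxx.
have all_ (u : necklace c q) : connect (@adj (necklace c q)) (inl (Ordinal zc)) u.
  case: u => [i|[e k]] //.
  have [g _ gK] := cyc_edge_bij.
  apply: connect_trans (cyc (g e)) (connect1 _) => /=.
  by rewrite -{2}(gK e) set21.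
by apply: connect_trans (all_ y); rewrite csym.
Qed.
End NecklaceStructure.

(** * Necklace counts as weighted closed walks *)

Definition clique_ext (G : sgraph) s (a b : G) (g : {ffun 'I_s -> G}) : bool :=
  [&& adj a b, [forall i, adj a (g i) && adj b (g i)]
    & [forall i, forall j, (i != j) ==> adj (g i) (g j)]].

(** For [s = q - 2] this is the entry of [M_q] at [(a, b)]; it is 0 when [ab] is not an edge. *)
Definition clique_weight (G : sgraph) s (a b : G) : nat :=
  \sum_(g : {ffun 'I_s -> G}) clique_ext a b g.

Lemma clique_weight_sym (G : sgraph) s (a b : G) :
  clique_weight s a b = clique_weight s b a.
Proof.
apply: eq_bigr => g _; congr nat_of_bool; rewrite /clique_ext adj_sym.
by congr [&& _, _ & _]; apply: eq_forallb => i; rewrite andbC.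
Qed.

(** New vertices on different edges are not adjacent, so once the cycle is mapped the edges are
    extended independently. The right-hand side is the trace of [M_q^c]. *)
Lemma hom_necklaceE c q (G : sgraph) : 2 < c ->
  hom_count (necklace c q) G =
  \sum_(x : {ffun 'I_c -> G}) \prod_i clique_weight (q - 2) (x i) (x (ordS i)).
Proof.
move=> hc; have [g ceK gK] := cyc_edge_bij hc.
pose Phi (p : {ffun 'I_c -> G} * {ffun 'I_c -> {ffun 'I_(q - 2) -> G}}) :
    {ffun necklace c q -> G} :=
  [ffun z => match z with inl i => p.1 i | inr (e, k) => p.2 (g e) k end].
pose Psi (f : {ffun necklace c q -> G}) :
    {ffun 'I_c -> G} * {ffun 'I_c -> {ffun 'I_(q - 2) -> G}} :=
  ([ffun i => f (inl i)], [ffun i => [ffun k => f (inr (cyc_edge hc i, k))]]).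
have PhiK : cancel Phi Psi.
  move=> [x h]; congr (_, _); apply/ffunP => i; rewrite !ffunE //=.
  by apply/ffunP => k; rewrite !ffunE ceK.
have PsiK : cancel Psi Phi.
  move=> f; apply/ffunP => -[i|[e k]]; rewrite !ffunE //=.
  by rewrite ?ffunE gK.
rewrite hom_countE (reindex Phi); last by exists Psi => z _.
rewrite sum_pair; apply: eq_bigr => x _; rewrite bigA_distr_bigA.
apply: eq_bigr => h _ /=; rewrite prod_nat_bool; congr nat_of_bool.
apply/forallP/forallP => [hom i|ext u].
  have homP u v : adj u v -> adj (Phi (x, h) u) (Phi (x, h) v).
    by move=> uv; have /forallP/(_ v)/implyP := hom u; apply.
  apply/and3P; split.
  - have := homP (inl i) (inl (ordS i)); rewrite !ffunE; apply.
    by rewrite /= /cycle_adj ordS_neq // eqxx.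
  - apply/forallP => k; apply/andP; split.
      have := homP (inl i) (inr (cyc_edge hc i, k)); rewrite !ffunE ceK; apply.
      by rewrite /= set21.
    have := homP (inl (ordS i)) (inr (cyc_edge hc i, k)); rewrite !ffunE ceK; apply.
    by rewrite /= set22.
  - apply/forallP => k; apply/forallP => k'; apply/implyP => kk'.
    have := homP (inr (cyc_edge hc i, k)) (inr (cyc_edge hc i, k')).
    by rewrite !ffunE !ceK; apply; rewrite /= eqxx.
have {}ext i := and3P (ext i).
have inlr (i : cycle_graph c) (e : {e | e \in edges (cycle_graph c)}) k :
    i \in val e -> adj (x i) (h (g e) k).
  rewrite -{1}(gK e) mem_cyc_edge.
  have [_ /forallP/(_ k)/andP[a1 a2] _] := ext (g e).
  by case/orP => /eqP ->.
apply/forallP => v; apply/implyP.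
case: u v => [i|[e k]] [j|[e' k']]; rewrite !ffunE /=.
- case/andP=> _ /orP[/eqP ->|/eqP ->]; first by have [] := ext i.
  by rewrite adj_sym; have [] := ext j.
- exact: inlr.
- by rewrite adj_sym; apply: inlr.
- case/andP=> /eqP <- kk'; have [_ _ /forallP/(_ k)/forallP/(_ k')/implyP] := ext (g e).
  exact.
Qed.

(** * Disjoint unions *)

Section DisjointUnion.
Variables (I : finType) (G : I -> sgraph).

Definition dunion_adj (x y : {i : I & G i}) : bool :=
  (tag x == tag y) && adj (tagged x) (tagged_as x y).

Lemma dunion_adjE (i : I) (u v : G i) :
  dunion_adj (Tagged G u) (Tagged G v) = adj u v.
Proof. by rewrite /dunion_adj eqxx tagged_asE. Qed.

Lemma dunion_adj_sym : symmetric dunion_adj.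
Proof.
move=> [i u] [j v]; have [E|ne] := eqVneq i j; last first.
  by rewrite /dunion_adj /= [j == i]eq_sym (negbTE ne).
by case: j / E v => v; rewrite !dunion_adjE adj_sym.
Qed.

Lemma dunion_adj_irr : irreflexive dunion_adj.
Proof. by move=> [i u]; rewrite dunion_adjE adj_irr. Qed.

Definition dunion : sgraph := SGraph dunion_adj_sym dunion_adj_irr.

(** The image of a connected graph stays in the component of the image of [u0]. A vertex is demanded
    because the empty graph has one map to the union but one to each component. *)
Lemma hom_dunion (F : sgraph) : F -> (forall u v : F, connect (@adj F) u v) ->
  hom_count F dunion = \sum_i hom_count F (G i).
Proof.
move=> u0 conn.
pose lft i (f : {ffun F -> G i}) : {ffun F -> dunion} := [ffun u => Tagged G (f u)].
have lft_inj i : injective (@lft i).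
  move=> f f' E; apply/ffunP => u; have /ffunP/(_ u) := E.
  by rewrite !ffunE => /eqP; rewrite -tag_eqE /tag_eq /= eqxx tagged_asE => /eqP.
have homE i (f : {ffun F -> G i}) :
    [forall u, forall v, adj u v ==> adj (lft i f u) (lft i f v)] =
    [forall u, forall v, adj u v ==> adj (f u) (f v)].
  by apply: eq_forallb => u; apply: eq_forallb => v; rewrite !ffunE /= dunion_adjE.
rewrite /hom_count -sum1_card.
rewrite (partition_big (fun f : {ffun F -> dunion} => tag (f u0)) xpredT) //=.
apply: eq_bigr => i _; rewrite sum1dep_card.
rewrite -(card_imset _ (lft_inj i)); apply: eq_card => f; rewrite !inE.
apply/andP/imsetP => [[/forallP hom /eqP tagu0]|[f' + ->]]; last first.
  by rewrite inE => hom; rewrite homE ffunE /=; split.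
have homP u v : adj u v -> dunion_adj (f u) (f v).
  by move=> uv; have /forallP/(_ v)/implyP := hom u; apply.
have tagE u : tag (f u) = i.
  have /connectP[s + ->] := conn u0 u.
  elim: s u0 tagu0 {conn} => [|w s IH] v //= tv /andP[/homP/andP[/eqP E _]].
  by apply: IH; rewrite -E.
have ex u : {y : G i | f u = Tagged G y}.
  by move: (tagE u); case: (f u) => j y /= E; case: _ / E; exists y.
pose f' := [ffun u => sval (ex u)].
have fE : f = lft i f' by apply/ffunP => u; rewrite !ffunE; case: (ex u).
by exists f' => //; rewrite inE -homE -fE; apply/forallP.
Qed.
End DisjointUnion.

(** * The tower graph and its homomorphism counts *)

Section TowerGraph.
Variables (N p b : nat).

(* A vertex [(j, h, _)] chooses, through the zeros of [h], which levels below [j]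
   it is joined to; the last component only makes copies of vertices. *)
Definition tower_lt (x y : 'I_N * {ffun 'I_N -> 'I_p} * 'I_b) : bool :=
  (x.1.1 < y.1.1) && (val (y.1.2 x.1.1) == 0).

Definition tower_adj x y := tower_lt x y || tower_lt y x.

Lemma tower_adj_sym : symmetric tower_adj.
Proof. by move=> x y; rewrite /tower_adj orbC. Qed.

Lemma tower_adj_irr : irreflexive tower_adj.
Proof. by move=> x; rewrite /tower_adj /tower_lt ltnn. Qed.

Definition tower : sgraph := SGraph tower_adj_sym tower_adj_irr.

Section Count.
Variable F : sgraph.

Definition lifts (a : {ffun F -> 'I_N}) : nat :=
  \sum_(h : {ffun F -> {ffun 'I_N -> 'I_p}})
    [forall u, forall v, adj u v ==>
      ((a u < a v) && (val (h v (a u)) == 0) || (a v < a u) && (val (h u (a v)) == 0))].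

Lemma hom_tower : hom_count F tower = b ^ #|F| * \sum_a lifts a.
Proof.
pose Phi (z : {ffun F -> 'I_b} * ({ffun F -> 'I_N} * {ffun F -> {ffun 'I_N -> 'I_p}})) :
    {ffun F -> tower} := [ffun u => (z.2.1 u, z.2.2 u, z.1 u)].
pose Psi (f : {ffun F -> tower}) : {ffun F -> 'I_b} *
    ({ffun F -> 'I_N} * {ffun F -> {ffun 'I_N -> 'I_p}}) :=
  ([ffun u => (f u).2], ([ffun u => (f u).1.1], [ffun u => (f u).1.2])).
have PhiK : cancel Phi Psi.
  by move=> [c [a h]]; congr (_, (_, _)); apply/ffunP => u; rewrite !ffunE.
have PsiK : cancel Psi Phi.
  by move=> f; apply/ffunP => u; rewrite !ffunE; case: (f u) => -[].
rewrite hom_countE (reindex Phi); last by exists Psi => z _.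
rewrite sum_pair (eq_bigr (fun=> \sum_a lifts a)).
  by rewrite sum_nat_const card_ffun card_ord.
move=> c _; rewrite sum_pair; apply: eq_bigr => a _; apply: eq_bigr => h _.
congr nat_of_bool; apply: eq_forallb => u; apply: eq_forallb => v.
by rewrite !ffunE.
Qed.

Lemma lifts_le (a : {ffun F -> 'I_N}) : lifts a <= p ^ (N * #|F|).
Proof.
apply: (@leq_trans (\sum_(h : {ffun F -> {ffun 'I_N -> 'I_p}}) 1)).
  by apply: leq_sum => h _; apply: leq_b1.
by rewrite sum1_card !card_ffun !card_ord expnM.
Qed.

Lemma card_ord_eq0 : 0 < p -> \sum_(y < p) (val y == 0) = 1.
Proof.
case: p => // p' _; rewrite (bigD1 ord0) //= big1 // => y.
by move=> ny; case: eqP => // E; case/eqP: ny; apply: val_inj.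
Qed.

(** When all levels differ, an edge [uv] with [a u < a v] forces exactly the coordinate [a u] of
    [h v] to be zero, and different edges force different coordinates. Each edge therefore costs a
    factor of exactly [p]. *)
Lemma lifts_inj (a : {ffun F -> 'I_N}) : 0 < p -> injective a ->
  lifts a * p ^ (\sum_u \sum_(v | adj u v) (a u < a v)) = p ^ (N * #|F|).
Proof.
move=> p0 ainj.
(* [S v t] marks the coordinates [t] of [h v] that are forced to be zero. *)
pose S v t := [exists u, [&& adj u v, a u == t & t < a v]].
have -> : lifts a = \prod_v \prod_t (if S v t then 1 else p).
  transitivity (\prod_v \prod_t \sum_(y < p) (S v t ==> (val y == 0))); last first.
    apply: eq_bigr => v _; apply: eq_bigr => t _; case: (S v t) => /=.
      exact: card_ord_eq0.
    by rewrite sum1_card card_ord.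
  under eq_bigr do rewrite bigA_distr_bigA.
  rewrite bigA_distr_bigA; apply: eq_bigr => h _.
  under eq_bigr do rewrite prod_nat_bool.
  rewrite prod_nat_bool; congr nat_of_bool.
  apply/forallP/forallP => [hom v|hS u].
    apply/forallP => t; apply/implyP => /existsP[u /and3P[uv /eqP <- auv]].
    have /forallP/(_ v)/implyP/(_ uv) := hom u.
    by rewrite auv ltnNge (ltnW auv) orbF.
  apply/forallP => v; apply/implyP => uv.
  have [auv|avu|E] := ltngtP (a u) (a v).
  - have /forallP/(_ (a u))/implyP := hS v; rewrite orbF; apply.
    by apply/existsP; exists u; rewrite uv eqxx.
  - have /forallP/(_ (a v))/implyP := hS u; apply.
    by apply/existsP; exists v; rewrite adj_sym uv eqxx.
  - by move: uv; rewrite (ainj u v (val_inj E)) adj_irr.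
have -> : \sum_u \sum_(v | adj u v) (a u < a v) = \sum_v \sum_t S v t.
  rewrite (exchange_big_dep xpredT) //=; apply: eq_bigr => v _.
  rewrite -!big_mkcondr /= !sum1dep_card -(card_imset _ ainj).
  apply: eq_card => t; rewrite !inE; apply/imsetP/existsP => [[u]|[u]].
    by rewrite inE => /andP[uv auv] ->; exists u; rewrite uv eqxx.
  by move=> /and3P[uv /eqP <- auv]; exists u; rewrite ?inE ?uv.
rewrite expn_sum -big_split /= (eq_bigr (fun=> p ^ N)); last first.
  move=> v _; rewrite expn_sum -big_split /= (eq_bigr (fun=> p)).
    by rewrite prod_nat_const card_ord.
  by move=> t _; case: (S v t); rewrite ?mul1n ?expn1 ?muln1.
by rewrite prod_nat_const -expnM.
Qed.

Lemma adj_pairs_inj (a : {ffun F -> 'I_N}) : injective a ->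
  adj_pairs F = 2 * \sum_u \sum_(v | adj u v) (a u < a v).
Proof.
move=> ainj; rewrite mul2n -addnn.
rewrite -[X in _ = _ + X](_ : \sum_u \sum_(v | adj u v) (a v < a u) = _); last first.
  rewrite (exchange_big_dep xpredT) //=; apply: eq_bigr => u _; apply: eq_big => // v.
  by rewrite adj_sym.
rewrite -big_split /=; apply: eq_bigr => u _; rewrite -big_split /= [RHS]big_mkcond.
apply: eq_bigr => v _; case: ifP => //= uv.
have [//|//|E] := ltngtP (a u) (a v).
by move: uv; rewrite (ainj u v (val_inj E)) adj_irr.
Qed.
End Count.
End TowerGraph.

(** Division-free form of: a map from [v] points to [n] points fails to be injective with
    probability at most [v^2 / n]. *)
Lemma ffact_ge n v : n ^ v.+1 <= n ^_ v * n + v ^ 2 * n ^ v.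
Proof.
elim: v => [|v IH]; first by rewrite ffactn0 expn1; lia.
have [vn|nv] := leqP n v.
  apply: leq_trans (leq_addl _ _).
  rewrite expnS leq_mul2r; apply/orP; right; nia.
rewrite ffactnSr.
have := leq_mul IH (leqnn (n - v)); rewrite !expnS; move: (n ^ v) (n ^_ v) => A B.
nia.
Qed.

(** Injective level maps contribute exactly, by [lifts_inj]; any other contributes between 0 and
    [Q]. Taking [p = t^2] turns [p] to the number of edges into [t ^ D], since [adj_pairs] counts
    every edge twice. *)
Lemma sum_lifts_bounds (N t : nat) (F : sgraph) (v := #|F|) (D := adj_pairs F)
    (Q := (t ^ 2) ^ (N * v)) : 0 < t ->
  N ^_ v * Q <= (\sum_a lifts (N := N) (t ^ 2) (F := F) a) * t ^ D
    <= N ^_ v * Q + (N ^ v - N ^_ v) * (t ^ D * Q).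
Proof.
move=> t0.
have injE (a : {ffun F -> 'I_N}) : injective a -> lifts (t ^ 2) a * t ^ D = Q.
  move=> ainj; rewrite /D (adj_pairs_inj ainj) expnM lifts_inj //.
  by rewrite expn_gt0 t0.
have cinj : #|[set a : {ffun F -> 'I_N} | injectiveb a]| = N ^_ v.
  by rewrite card_inj_ffuns card_ord.
have cT : #|[set a : {ffun F -> 'I_N} | ~~ injectiveb a]| = N ^ v - N ^_ v.
  have := cardC [set a : {ffun F -> 'I_N} | injectiveb a].
  rewrite cinj card_ffun card_ord => <-; rewrite addKn.
  by apply: eq_card => a; rewrite !inE.
rewrite (bigID (fun a : {ffun F -> 'I_N} => injectiveb a)) /= mulnDl.
have -> : (\sum_(a : {ffun F -> 'I_N} | injectiveb a) lifts (t ^ 2) a) * t ^ D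
    = N ^_ v * Q.
  rewrite big_distrl /= (eq_bigr (fun=> Q)); last by move=> a /injectiveP/injE.
  by rewrite sum_nat_const -cinj cardsE.
rewrite leq_addr leq_add2l /= mulnCA mulnC leq_mul2l -cT cardsE -sum_nat_const.
by apply/orP; right; apply: leq_sum => a _; apply: lifts_le.
Qed.

Local Open Scope ring_scope.

Lemma ffact_le n v : (n ^_ v <= n ^ v)%N.
Proof.
elim: v => [|v IH]; first by rewrite ffactn0.
by rewrite ffactnSr expnSr leq_mul // leq_subr.
Qed.

(** [Z] counts all vertex maps, and [t ^ D] undoes the edge density [1/t^2]. Non-injective level
    maps are a fraction at most [v^2 / N] of all, each overweighted by at most [t ^ D], whence the
    relative error. *)
Lemma hom_tower_bound (R : realType) (N t b : nat) (F : sgraph)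
    (Z : R := (N%:R * (t%:R ^+ 2) ^+ N * b%:R) ^+ #|F|) (D := adj_pairs F) :
  (0 < N)%N -> (0 < t)%N ->
  `|(hom_count F (tower N (t ^ 2) b))%:R * t%:R ^+ D - Z|
    <= (#|F|%:R ^+ 2 * t%:R ^+ D / N%:R) * Z.
Proof.
move=> N0 t0; set v := #|F|.
have /andP[lo hi] := sum_lifts_bounds N F t0.
rewrite hom_tower; move: lo hi; rewrite -/v -/D.
move: (\sum_a _)%N => L; set Q := ((t ^ 2) ^ (N * v))%N => lo hi.
have ff := ffact_ge N v; have fl := ffact_le N v.
have t1 : (1 <= t ^ D)%N by rewrite expn_gt0 t0.
have ZE : Z = b%:R ^+ v * (N%:R ^+ v * Q%:R).
  by rewrite /Z 2!exprMn -/v /Q natrX natrX -!exprM mulnA mulrC.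
rewrite ZE natrM natrX; move: (b%:R ^+ v) (exprn_ge0 v (ler0n R b)) => B B0.
have -> : B * L%:R * t%:R ^+ D - B * (N%:R ^+ v * Q%:R) =
  B * ((L * t ^ D)%:R - (N ^ v * Q)%:R) by rewrite !natrM !natrX; ring.
rewrite normrM (ger0_norm B0) mulrCA ler_wpM2l // {B B0 ZE Z}.
rewrite -!natrX -natrM.
have N0' : (0 : R) < N%:R by rewrite ltr0n.
rewrite -(ler_pM2r N0') [leRHS]mulrAC mulfVK ?gt_eqF // -!natrM.
have key : ((N ^ v - N ^_ v) * N <= v ^ 2 * N ^ v)%N.
  by rewrite mulnBl leq_subLR mulnC -expnS.
have step (y : nat) : (y <= (N ^ v - N ^_ v) * (t ^ D * Q))%N ->
    (y * N <= v ^ 2 * t ^ D * (N ^ v * Q))%N.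
  move=> /leq_mul/(_ (leqnn N))/leq_trans; apply.
  by rewrite mulnAC [(v ^ 2 * _ * _)%N]mulnACA leq_mul2r key orbT.
have [hh|hh] := leqP (N ^ v * Q) (L * t ^ D).
  rewrite -natrB // ger0_norm ?ler0n // -natrM ler_nat; apply: step.
  rewrite leq_subLR; apply: leq_trans hi _.
  by rewrite leq_add2r leq_mul2r fl orbT.
rewrite distrC -natrB 1?ltnW // ger0_norm ?ler0n // -natrM ler_nat; apply: step.
apply: leq_trans (leq_sub2l _ lo) _; rewrite -mulnBl leq_mul2l.
by rewrite leq_pmull ?orbT.
Qed.

(** * Closed walks and power sums of eigenvalues *)

Lemma sum_ffun_cycle (K : comNzRingType) n c (d : 'I_n -> K) : (0 < c)%N ->
  \sum_(k : {ffun 'I_c -> 'I_n}) \prod_i (d (k i) * (k i == k (ordS i))%:R)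
  = \sum_t d t ^+ c.
Proof.
case: c => // c _.
transitivity (\sum_(t < n) \sum_(k : {ffun 'I_c.+1 -> 'I_n} | k == [ffun=> t]) d t ^+ c.+1);
  last by apply: eq_bigr => t _; rewrite big_pred1_eq.
rewrite (partition_big (fun k : {ffun 'I_c.+1 -> 'I_n} => k ord0) xpredT) //=.
apply: eq_bigr => t _.
rewrite (bigID (fun k => k == [ffun=> t])) /= [X in _ + X]big1 ?addr0.
  apply: eq_big => [k|k].
    by apply: andb_idl => /eqP ->; rewrite ffunE.
  case/andP=> _ /eqP ->; rewrite (eq_bigr (fun=> d t)); last first.
    by move=> i _; rewrite !ffunE eqxx mulr1.
  by rewrite prodr_const card_ord.
move=> k /andP[/eqP k0 nk].
have [/forallP hk|/forallPn[i /negbTE ki]] := boolP [forall i, k i == k (ordS i)].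
  case/eqP: nk; apply/ffunP => -[i ic]; rewrite ffunE.
  elim: i ic => [|i IH] ic; first by rewrite -k0; congr (k _); apply: val_inj.
  rewrite -(IH (ltnW ic)) (eqP (hk (Ordinal (ltnW ic)))); congr (k _).
  by apply: val_inj; rewrite /= modn_small.
by rewrite (bigD1 i) //= ki mulr0 mul0r.
Qed.

(** Conjugation invariance of the trace of a power, carried out on closed walks: summing over the
    walk [x] first contracts each [P *m invmx P] to the identity, and only constant eigenvalue
    indices [k] survive. *)
Lemma sum_cycle_diag (K : comUnitRingType) n c (P : 'M[K]_n) (d : 'rV[K]_n) :
  P \in unitmx -> (0 < c)%N ->
  \sum_(x : {ffun 'I_c -> 'I_n})
    \prod_i (invmx P *m diag_mx d *m P) (x i) (x (ordS i)) = \sum_t d 0 t ^+ c.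
Proof.
move=> Pu c0; rewrite -(sum_ffun_cycle (fun t => d 0 t) c0).
have E (x : {ffun 'I_c -> 'I_n}) :
   \prod_i (invmx P *m diag_mx d *m P) (x i) (x (ordS i)) =
   \sum_(k : {ffun 'I_c -> 'I_n})
     \prod_i (d 0 (k i) * (P (k i) (x (ordS i)) * invmx P (x (ordS i)) (k (ordS i)))).
  transitivity (\prod_i \sum_k (invmx P (x i) k * d 0 k * P k (x (ordS i)))).
    apply: eq_bigr => i _; rewrite mxE; apply: eq_bigr => k _; congr (_ * _).
    by rewrite mul_mx_diag mxE.
  rewrite bigA_distr_bigA; apply: eq_bigr => k _.
  rewrite !big_split /=.
  (* A cyclic shift puts each factor of [invmx P] next to the factor of [P] with the same walk
     vertex. *)
  have -> : \prod_i invmx P (x (ordS i)) (k (ordS i)) = \prod_i invmx P (x i) (k i).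
    by rewrite [RHS](reindex_inj (@ordS_inj _)).
  by rewrite -mulrA mulrC mulrA.
rewrite (eq_bigr _ (fun x _ => E x)) exchange_big /=; apply: eq_bigr => k _.
under eq_bigr do rewrite big_split /=.
rewrite -big_distrr /= big_split /=; congr (_ * _).
rewrite (reindex_onto (fun y : {ffun 'I_c -> 'I_n} => [ffun i => y (ord_pred i)])
   (fun x => [ffun i => x (ordS i)])); last first.
  by move=> x _; apply/ffunP => i; rewrite !ffunE ord_predK.
rewrite (eq_bigl xpredT); last first.
  by move=> y; apply/eqP/ffunP => i; rewrite !ffunE ordSK.
transitivity (\prod_i \sum_t (P (k i) t * invmx P t (k (ordS i)))).
  rewrite bigA_distr_bigA; apply: eq_bigr => y _; apply: eq_bigr => i _.
  by rewrite !ffunE ordSK.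
apply: eq_bigr => i _; have := mulmxV Pu => /matrixP/(_ (k i) (k (ordS i))).
by rewrite !mxE.
Qed.

(** The matrix of [w] is diagonalised over [R[i]] by the spectral theorem; being hermitian it has
    real eigenvalues, so taking real parts loses nothing. *)
Lemma cycle_sum_spectrum (R : realType) (T : finType) (w : T -> T -> nat) :
  (forall a b, w a b = w b a) ->
  exists d : 'I_#|T| -> R, forall c, (0 < c)%N ->
    (\sum_(x : {ffun 'I_c -> T}) \prod_i w (x i) (x (ordS i)))%:R = \sum_t d t ^+ c.
Proof.
move=> wsym.
pose A : 'M[R[i]]_#|T| := \matrix_(i, j) (w (enum_val i) (enum_val j))%:R.
have Aherm : A \is hermsymmx.
  apply: realsym_hermsym.
    apply/is_hermitianmxP; rewrite expr0 scale1r; apply/matrixP => i j.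
    by rewrite !mxE wsym.
  by apply/mxOverP => i j; rewrite mxE realn.
have /mxOverP Dreal := hermitian_spectral_diag_real Aherm.
have /hermitian_normalmx/orthomx_spectralP AE := Aherm.
exists (fun t => complex.Re (spectral_diag A 0 t)) => c c0.
apply: (@complexI R); rewrite rmorph_nat [RHS]rmorph_sum.
rewrite (eq_bigr (fun t => spectral_diag A 0 t ^+ c)); last first.
  by move=> t _; rewrite /= rmorphXn /= RRe_real ?Dreal.
rewrite -(sum_cycle_diag _ (spectral_unit A) c0) -AE.
rewrite (reindex (fun x : {ffun 'I_c -> 'I_#|T|} => [ffun i => enum_val (x i)])).
  rewrite natr_sum; apply: eq_bigr => x _; rewrite natr_prod; apply: eq_bigr => i _.
  by rewrite !ffunE mxE.
exists (fun x : {ffun 'I_c -> T} => [ffun i => enum_rank (x i)]) => x _;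
  apply/ffunP => i; rewrite !ffunE.
  exact: enum_valK.
exact: enum_rankK.
Qed.

Local Open Scope classical_set_scope.
Local Open Scope ring_scope.

(** * Closures of sets of matrices *)

Section MatrixClosure.
Variables (R : realType) (m n : nat).
Implicit Types (A : set 'M[R]_(m, n)) (M : 'M[R]_(m, n)).

Lemma closure_mxP A M : closure A M <->
  (forall e : R, 0 < e ->
     exists2 M', A M' & forall i j, `|M i j - M' i j| < e).
Proof.
split=> [cl e e0|h B /nbhs_ballP[e /= e0 eB]].
  have [M' [AM' [_ MM']]] := cl _ (nbhsx_ballx M e e0).
  by exists M' => // i j; apply: MM'.
have [M' AM' MM'] := h e e0; exists M'; split=> //; apply: eB.
by split=> // i j; apply: MM'.
Qed.

Lemma closure_mx_cvg A M (u : nat -> 'M[R]_(m, n)) :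
  (\forall k \near \oo, A (u k)) ->
  (forall i j, u k i j @[k --> \oo] --> M i j) -> closure A M.
Proof.
move=> Au uM; apply/closure_mxP => e e0.
have near_e : \forall k \near \oo, forall i j, `|M i j - u k i j| < e.
  apply: filter_forall => i; apply: filter_forall => j.
  by have /cvgrPdist_lt/(_ e e0) := uM i j.
near \oo => k; exists (u k); first by near: k.
by near: k.
Unshelve. all: by end_near. Qed.

End MatrixClosure.

(** Rows can be approximated independently and assembled into one matrix. *)
Lemma closure_profile_power (R : realType) (m n : nat) (A : set 'rV[R]_n) :
  closure (profile_power m A) = profile_power m (closure A).
Proof.
apply/seteqP; split=> [M /closure_mxP cl i|M cl].
  apply/closure_mxP => e e0; have [M' AM' MM'] := cl e e0.
  by exists (row i M') => // i' j; rewrite !mxE.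
apply/closure_mxP => e e0.
have ex i : exists y : 'rV[R]_n, A y /\ forall j, `|M i j - y 0 j| < e.
  have /closure_mxP/(_ e e0)[y Ay yM] := cl i.
  by exists y; split=> // j; have := yM 0 j; rewrite mxE.
have [f fP] := choice ex.
exists (\matrix_(i, j) f i 0 j) => [i|i j]; last by rewrite mxE; have [] := fP i.
rewrite (_ : row i _ = f i); first by have [] := fP i.
by apply/rowP => j; rewrite !mxE.
Qed.

(** * Rows of necklace points are power-sum points *)

Lemma necklace_point_row (R : realType) (l r : nat) (G : sgraph) (i : 'I_(r - 1)) :
  hom_count (necklace 4 (i + 2)) G <> 0%N ->
  @power_sum_points R #|G| l (row i (necklace_point R l r G)).
Proof.
move=> h0.
have [d dE] := @cycle_sum_spectrum R G _ (@clique_weight_sym G (i + 2 - 2)).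
have homE j : (hom_count (necklace (4 * j.+1) (i + 2)) G)%:R =
    \sum_t (d t ^+ 4) ^+ j.+1 :> R.
  rewrite hom_necklaceE ?dE; [|lia|lia].
  by apply: eq_bigr => t _; rewrite exprM.
have hom1 : (hom_count (necklace 4 (i + 2)) G)%:R = \sum_t d t ^+ 4 :> R.
  by have := homE 0%N; rewrite muln1 => ->; apply: eq_bigr => t _; rewrite expr1.
set s := (hom_count (necklace 4 (i + 2)) G)%:R in hom1.
have s0 : s != 0 by rewrite pnatr_eq0; apply/eqP.
(* By [hom1] these entries sum to 1; the even power makes them nonnegative whatever the signs of the
   eigenvalues. *)
exists (\row_t (d t ^+ 4 / s)); split.
- move=> t; rewrite mxE divr_ge0 ?ler0n //.
  by rewrite (exprM _ 2 2) sqr_ge0.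
- rewrite /power_sum; under eq_bigr do rewrite mxE expr1.
  by rewrite -mulr_suml -hom1 divff.
- apply/rowP => k; rewrite !mxE -/s addn2 homE /power_sum mulr_suml.
  by apply: eq_bigr => t _; rewrite mxE expr_div_n.
Qed.

(** * Normalised necklace counts of a single tower *)

Lemma tower_exponent (r q q' N : nat) : (q <= r)%N -> (q' <= r)%N ->
  (2 * (r - q') * (N * 2) + 4 * q' * N + (r ^ 2 - q' ^ 2) + (q - q' + (q' - q)) ^ 2 =
   4 * r * N + (r - q) ^ 2 + 2 * (r - q') * q)%N.
Proof.
move=> qr qr'.
(* The terms in [N] agree, and the rest is [r^2 - q'^2 + (q-q')^2 = (r-q)^2 + 2(r-q')q]. The sum
   [q - q' + (q' - q)] encodes the absolute difference. *)
have -> : (r ^ 2 - q' ^ 2 = (r - q') * (r + q'))%N by rewrite subn_sqr.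
have [qq'|/ltnW qq'] := leqP q q'.
  have [a aE] : {a | q' = q + a}%N by exists (q' - q)%N; lia.
  have [b bE] : {b | r = q' + b}%N by exists (r - q')%N; lia.
  have -> : (r - q' = b)%N by lia.
  have -> : (q - q' + (q' - q) = a)%N by lia.
  have -> : (r - q = a + b)%N by lia.
  subst; nia.
have [a aE] : {a | q = q' + a}%N by exists (q - q')%N; lia.
have [b bE] : {b | r = q + b}%N by exists (r - q)%N; lia.
have -> : (r - q' = a + b)%N by lia.
have -> : (q - q' + (q' - q) = a)%N by lia.
have -> : (r - q = b)%N by lia.
subst; nia.
Qed.

Section TowerTerm.
Variables (R : realType) (r q q' j m P N : nat).
Hypotheses (hq : (2 <= q <= r)%N) (hq' : (2 <= q' <= r)%N) (j0 : (0 < j)%N).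
Hypotheses (P0 : (0 < P)%N) (N0 : (0 < N)%N).
Let v := (4 * j * (q - 1))%N.
Let S : R := N%:R * P%:R ^+ (4 * r * N + (r - q) ^ 2).

(** [S] does not depend on [q']; after division by [S ^+ v] the main term is [m P^(-(q-q')^2)] to
    the power [v]. The hypothesis on [N] says exactly that the relative error in [hom_tower_bound]
    is at most [1/P]. *)
Lemma tower_term_bound :
  (v ^ 2 * P ^ (2 * (r - q') * (v * q)) * P <= N)%N ->
  `|(hom_count (necklace (4 * j) q) (tower N ((P ^ (2 * (r - q'))) ^ 2)
        (P ^ (4 * q' * N + (r ^ 2 - q' ^ 2)) * m)))%:R / S ^+ v
     - (q == q')%:R * m%:R ^+ v| <= 2 * m%:R ^+ v / P%:R.
Proof.
move=> Nbig.
have hc : (2 < 4 * j)%N by lia.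
have q2 : (2 <= q)%N by case/andP: hq.
have vE : #|necklace (4 * j) q| = v by rewrite card_necklace.
have DE : adj_pairs (necklace (4 * j) q) = (v * q)%N by rewrite adj_pairs_necklace.
set t := (P ^ (2 * (r - q')))%N.
set b := (P ^ (4 * q' * N + (r ^ 2 - q' ^ 2)) * m)%N.
have t0 : (0 < t)%N by rewrite expn_gt0 P0.
have := @hom_tower_bound R N t b (necklace (4 * j) q) N0 t0.
rewrite vE DE; set h := hom_count _ _.
pose dl := ((q - q') + (q' - q))%N.
have P0' : (0 : R) < P%:R by rewrite ltr0n.
have N0' : (0 : R) < N%:R by rewrite ltr0n.
have S0 : 0 < S by rewrite mulr_gt0 // exprn_gt0.
pose tau : R := t%:R ^+ q.
have tau0 : 0 < tau by rewrite exprn_gt0 // ltr0n.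
have -> : N%:R * (t%:R ^+ 2) ^+ N * b%:R = S * tau * (m%:R / P%:R ^+ (dl ^ 2)).
  rewrite /b /S /tau /t natrM !natrX.
  apply: (mulIf (lt0r_neq0 (exprn_gt0 (dl ^ 2) P0'))).
  rewrite !mulrA mulfVK ?gt_eqF ?exprn_gt0 // -!exprM mulrAC.
  congr (_ * _); rewrite -!mulrA -!exprD.
  congr (_ * _ ^+ _).
  by rewrite [(2 * N)%N]mulnC !addnA tower_exponent //; case/andP: hq hq' => _ ? /andP[].
rewrite exprMn mulnC exprM -/tau.
have K0 : 0 < (S * tau) ^+ v by rewrite exprn_gt0 // mulr_gt0.
set y := m%:R / _.
have y0 : 0 <= y by rewrite divr_ge0 ?exprn_ge0 ?ler0n.
have -> : h%:R * tau ^+ v - (S * tau) ^+ v * y ^+ v =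
    (S * tau) ^+ v * (h%:R / S ^+ v - y ^+ v).
  rewrite mulrBr; congr (_ - _).
  by rewrite exprMn [RHS]mulrC mulrA mulfVK // gt_eqF ?exprn_gt0.
rewrite normrM (gtr0_norm K0) mulrCA (ler_pM2l K0).
set eps := _ / N%:R.
have eps_le : eps <= P%:R^-1.
  rewrite /eps ler_pdivrMr // ler_pdivlMl // mulrC.
  by rewrite /tau -exprM mulnC -!natrX -!natrM ler_nat /t -expnM.
have P1 : P%:R^-1 <= 1 :> R by rewrite invf_le1 // ler1n.
have yv0 : 0 <= y ^+ v by rewrite exprn_ge0.
have mv0 : 0 <= m%:R ^+ v :> R by rewrite exprn_ge0 ?ler0n.
have Pi0 : 0 <= P%:R^-1 :> R by rewrite invr_ge0 ltW.
case: eqVneq => [qq'|qq'] hy.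
  have yE : y = m%:R by rewrite /y /dl qq' subnn expr0 divr1.
  rewrite mul1r; rewrite yE in hy; apply: le_trans hy _.
  have := ler_wpM2r mv0 eps_le; have := mulr_ge0 Pi0 mv0; lra.
(* For [q <> q'] the exponent [(q-q')^2 v] is at least 1, so the main term is itself at most
   [m^v / P]; the error is no larger, hence the constant 2. *)
have yv : y ^+ v <= m%:R ^+ v / P%:R.
  rewrite /y expr_div_n ler_wpM2l // lef_pV2 ?posrE ?exprn_gt0 //.
  rewrite -exprM -[leLHS]expr1 ler_weXn2l ?ler1n // muln_gt0 expn_gt0.
  rewrite /v !muln_gt0 j0 subn_gt0 q2 andbT orbF /dl; lia.
rewrite mul0r subr0.
have := ler_wpM2r yv0 (le_trans eps_le P1); rewrite mul1r => hy2.
have := le_trans hy hy2; rewrite ler_norml => /andP[_ hy3].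
rewrite ger0_norm ?divr_ge0 ?exprn_ge0 ?ler0n ?(ltW S0) //.
lra.
Qed.
End TowerTerm.

(** * Limits of real sequences *)

Lemma cvg_bounded_harmonic (R : realType) (u : nat -> R) (a C : R) :
  (forall k, `|u k - a| <= C / k.+1%:R) -> u k @[k --> \oo] --> a.
Proof.
move=> uC.
have hC : C / k.+1%:R @[k --> \oo] --> (0 : R).
  rewrite -[0](mulr0 C); apply: cvgM; [exact: cvg_cst|exact: cvg_harmonic].
apply: (@squeeze_cvgr _ _ _ _ (fun k => a - C / k.+1%:R) (fun k => a + C / k.+1%:R)).
- by apply: nearW => k; have := uC k; rewrite ler_distl.
- by rewrite -[X in _ --> X]subr0; apply: cvgB => //; apply: cvg_cst.
- by rewrite -[X in _ --> X]addr0; apply: cvgD => //; apply: cvg_cst.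
Qed.

Lemma cvg_expn (R : realType) (u : nat -> R) (a : R) n :
  u k @[k --> \oo] --> a -> u k ^+ n @[k --> \oo] --> a ^+ n.
Proof. by move=> ua; exact: (cvg_comp _ _ ua (@exprn_continuous R n a)). Qed.

Lemma cvg_power_ratio (R : realType) (u s : nat -> R) (a b : R) n : b != 0 ->
  u k @[k --> \oo] --> a -> s k @[k --> \oo] --> b ->
  u k / s k ^+ n @[k --> \oo] --> a / b ^+ n.
Proof.
move=> b0 ua sb; apply: cvgM => //.
by apply: cvgV; [rewrite expf_neq0|apply: cvg_expn].
Qed.

Lemma cvg_sum_ord (R : realType) n (u : 'I_n -> nat -> R) (a : 'I_n -> R) :
  (forall i, u i k @[k --> \oo] --> a i) ->
  \sum_i u i k @[k --> \oo] --> \sum_i a i.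
Proof. by move=> ua; apply: cvg_big => // z; apply: add_continuous. Qed.

(** * Unions of towers and their limiting ratios *)

Section MixedTowers.
Variables (R : realType) (l r : nat) (n : 'I_(r - 1) -> nat).
Variable m : forall i, 'I_(n i) -> nat.

(** One number of levels for all towers, large enough for [tower_term_bound] at every [j <= l] and
    [q <= r]. *)
Definition height (P : nat) : nat := ((4 * l * r) ^ 2 * P ^ (8 * l * r ^ 3) * P)%N.

(** The exponent [4 * q * N] of the copies compensates the [q]-dependence of [p^N], so that the
    vertex number of a tower is [P^(r^2 - q^2) * m x] times a factor common to all towers. *)
Definition mixed_tower (P : nat) : sgraph :=
  dunion (fun i : 'I_(r - 1) => dunion (fun x : 'I_(n i) =>
    let q := (i + 2)%N in let N := height P in
    tower N ((P ^ (2 * (r - q))) ^ 2)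
      (P ^ (4 * q * N + (r ^ 2 - q ^ 2)) * m x))).

Definition power_total (i : 'I_(r - 1)) (e : nat) : R := \sum_x (m (i := i) x)%:R ^+ e.

(** The quantity [n p^(-q/2)] of a tower built for [q = i + 2] with [m x = 1]. *)
Definition scale (i : 'I_(r - 1)) (P : nat) : R :=
  (height P)%:R * P%:R ^+ (4 * r * height P + (r - (i + 2)) ^ 2).

Hypotheses (hl : (0 < l)%N) (hr : (2 <= r)%N).

Lemma height_gt0 P : (0 < P)%N -> (0 < height P)%N.
Proof. by move=> P0; rewrite /height !muln_gt0 ?expn_gt0 ?muln_gt0 P0 hl (ltnW hr). Qed.

Lemma scale_gt0 i P : (0 < P)%N -> 0 < scale i P.
Proof.
by move=> P0; rewrite mulr_gt0 ?exprn_gt0 // ltr0n ?height_gt0.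
Qed.

Lemma height_large (j q q' P : nat) : (j <= l)%N -> (q <= r)%N -> (0 < P)%N ->
  ((4 * j * (q - 1)) ^ 2 * P ^ (2 * (r - q') * (4 * j * (q - 1) * q)) * P
    <= height P)%N.
Proof.
move=> jl qr P0; have q1r : (q - 1 <= r)%N by lia.
have v1 : (4 * j * (q - 1) <= 4 * l * r)%N by rewrite !leq_mul.
rewrite /height !leq_mul ?leq_exp2r // leq_pexp2l //.
have -> : (8 * l * r ^ 3 = 2 * r * (4 * l * r * r))%N by rewrite !expnS; lia.
by rewrite leq_mul // ?leq_mul // leq_subr.
Qed.

Lemma hom_mixed_tower (i : 'I_(r - 1)) (j P : nat) : (0 < j <= l)%N -> (0 < P)%N ->
  `|(hom_count (necklace (4 * j) (i + 2)) (mixed_tower P))%:R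
      / scale i P ^+ (4 * j * (i + 1)) - power_total i (4 * j * (i + 1))|
  <= (2 * \sum_i' power_total i' (4 * j * (i + 1))) / P%:R.
Proof.
case/andP=> j0 jl P0; set v := (4 * j * (i + 1))%N.
have hc : (2 < 4 * j)%N by lia.
have zc : (0 < 4 * j)%N by lia.
have hom_sum (I : finType) (G : I -> sgraph) :
    hom_count (necklace (4 * j) (i + 2)) (dunion G) =
    \sum_x hom_count (necklace (4 * j) (i + 2)) (G x).
  by apply: hom_dunion; [exact: (inl (Ordinal zc))|exact: necklace_connected].
rewrite /mixed_tower hom_sum natr_sum mulr_suml.
(* The limit is spread over all blocks with a Kronecker delta, to be compared tower by tower. *)
have -> : power_total i v = \sum_i' (i == i')%:R * power_total i' v.
  rewrite (bigD1 i) //= eqxx mul1r big1 ?addr0 // => i' /negbTE.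
  by rewrite eq_sym => ->; rewrite mul0r.
rewrite -sumrB mulrAC mulr_sumr; apply: le_trans (ler_norm_sum _ _ _) _.
apply: ler_sum => i' _; rewrite hom_sum natr_sum mulr_suml /power_total.
rewrite !mulr_sumr -sumrB; apply: le_trans (ler_norm_sum _ _ _) _.
apply: ler_sum => x _.
have iE : (i + 2 - 1 = i + 1)%N by lia.
have := @tower_term_bound R r (i + 2) (i' + 2) j (m x) P (height P).
rewrite iE -/v -/(scale i P) eqn_add2r mulrAC; apply=> //.
- by have := ltn_ord i; lia.
- by have := ltn_ord i'; lia.
- exact: height_gt0.
- have := @height_large j (i + 2) (i' + 2) P jl _ P0; rewrite iE; apply.
  by have := ltn_ord i; lia.
Qed.

Hypotheses (n_gt0 : forall i, (0 < n i)%N) (m_gt0 : forall i (x : 'I_(n i)), (0 < m x)%N).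

Lemma power_total_gt0 i e : 0 < power_total i e.
Proof.
rewrite /power_total (bigD1 (Ordinal (n_gt0 i))) //= ltr_pwDl //.
  by rewrite exprn_gt0 // ltr0n.
by rewrite sumr_ge0 // => x _; rewrite exprn_ge0 ?ler0n.
Qed.

Lemma power_total_ratio_profile :
  necklace_profile R l r (\matrix_(i < r - 1, k < l - 1)
    (power_total i (4 * (k + 2) * (i + 1)) /
     power_total i (4 * (i + 1)) ^+ (k + 2))).
Proof.
have cvg_norm (i : 'I_(r - 1)) j : (0 < j <= l)%N ->
    (hom_count (necklace (4 * j) (i + 2)) (mixed_tower k.+1))%:R
      / scale i k.+1 ^+ (4 * j * (i + 1)) @[k --> \oo]
    --> power_total i (4 * j * (i + 1)).
  by move=> hj; apply: cvg_bounded_harmonic => k; apply: hom_mixed_tower.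
have cvg1 (i : 'I_(r - 1)) : (hom_count (necklace 4 (i + 2)) (mixed_tower k.+1))%:R
      / scale i k.+1 ^+ (4 * (i + 1)) @[k --> \oo]
    --> power_total i (4 * (i + 1)).
  by have := cvg_norm i 1%N; rewrite muln1; apply; rewrite hl.
apply: (closure_mx_cvg (u := fun k => necklace_point R l r (mixed_tower k.+1))).
  (* The limits are positive, so the nonvanishing condition on the graph holds for all large [k]. *)
  have : \forall k \near \oo, forall i : 'I_(r - 1),
      0 < (hom_count (necklace 4 (i + 2)) (mixed_tower k.+1))%:R
        / scale i k.+1 ^+ (4 * (i + 1)).
    apply: filter_forall => i; apply: (cvgr_gt _ (cvg1 i)); exact: power_total_gt0.
  apply: filterS => k pos; exists (mixed_tower k.+1); split=> // q /andP[q2 qr].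
  have qi : (q - 2 < r - 1)%N by lia.
  have := pos (Ordinal qi); rewrite /= subnK // => + E.
  by rewrite E mul0r ltxx.
move=> i k; rewrite mxE.
under eq_cvg => p do rewrite mxE.
have kl : (0 < k + 2 <= l)%N by have := ltn_ord k; lia.
have := cvg_power_ratio (n := (k + 2)%N)
  (lt0r_neq0 (power_total_gt0 _ _)) (cvg_norm i _ kl) (cvg1 i).
apply: cvg_trans; apply: near_eq_cvg; apply: nearW => p.
(* Numerator and denominator carry the same power of [scale], which cancels. *)
rewrite expr_div_n -exprM -mulnA [((k + 2) * _)%N]mulnC mulnA.
have s0 : scale i p.+1 ^+ (4 * (i + 1) * (k + 2)) != 0.
  by rewrite expf_neq0 // gt_eqF // scale_gt0.
by rewrite invf_div mulrA divfK.
Qed.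

End MixedTowers.

(** * Realising products of power-sum points, and the conclusion *)

Lemma power_sum_points_profile (R : realType) (l r : nat) :
  (0 < l)%N -> (2 <= r)%N ->
  profile_power (r - 1) (\bigcup_(n in [set: nat]) @power_sum_points R n l)
    `<=` necklace_profile R l r.
Proof.
move=> hl hr M hM.
have ex i : exists nx : {n : nat & 'rV[R]_n}, [/\ forall j, 0 <= projT2 nx 0 j,
    power_sum (projT2 nx) 1 = 1
    & row i M = \row_(k < l - 1) power_sum (projT2 nx) (k + 2)].
  by have [n _ [x hx]] := hM i; exists (existT _ n x).
have [nx nxP] := choice ex.
pose n i := projT1 (nx i); pose x i : 'rV[R]_(n i) := projT2 (nx i).
have x0 i j : 0 <= x i 0 j by have [] := nxP i.
have x1 i : power_sum (x i) 1 = 1 by have [] := nxP i.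
have xM i k : M i k = power_sum (x i) (k + 2).
  by have [_ _ /rowP/(_ k)] := nxP i; rewrite !mxE.
have n0 i : (0 < n i)%N.
  rewrite lt0n; apply/eqP => E; have /eqP := x1 i; rewrite /power_sum.
  by rewrite big1 ?(eq_sym 0) ?oner_eq0 // => -[j hj]; exfalso; rewrite E in hj.
(* The root of order [4(q-1)] for [q = i + 2], since the limiting ratios involve the powers
   [m^(4(q-1))]. *)
pose z (i : 'I_(r - 1)) j := x i 0 j `^ (4 * (i + 1))%:R^-1.
have z0 i j : 0 <= z i j by apply: powR_ge0.
have zX i j : z i j ^+ (4 * (i + 1)) = x i 0 j.
  rewrite -powR_mulrn // -powRrM mulVf ?powRr1 // pnatr_eq0; lia.
(* Integers with [m / K] within [1/K] of [z]; the successor keeps them positive even where [z] is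
   0. *)
pose m (K : nat) i j := (Num.truncn (K%:R * z i j)).+1.
have cvg_m i j : (m k.+1 i j)%:R / k.+1%:R @[k --> \oo] --> z i j.
  apply: (@cvg_bounded_harmonic _ _ _ 1) => k.
  have K0 : (0 : R) < k.+1%:R by rewrite ltr0n.
  have /truncn_itv/andP[t1 t2] : 0 <= k.+1%:R * z i j by rewrite mulr_ge0.
  rewrite -[X in _ - X](mulfK (lt0r_neq0 K0)) -mulrBl normrM.
  rewrite [`|_^-1|]gtr0_norm ?invr_gt0 // ler_pM2r ?invr_gt0 //.
  rewrite mulrC ger0_norm ?subr_ge0 ?(ltW t2) //.
  by rewrite /m lerBlDr -(natr1 (Num.truncn _)) addrC lerD2l.
have cvg_total i j : power_total R (m k.+1) i (4 * (i + 1) * j)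
      / k.+1%:R ^+ (4 * (i + 1) * j) @[k --> \oo] --> power_sum (x i) j.
  rewrite /power_total /power_sum.
  under eq_cvg => k do rewrite mulr_suml.
  apply: cvg_sum_ord => y; rewrite -zX -exprM.
  under eq_cvg => k do rewrite -expr_div_n.
  exact: cvg_expn.
apply: closed_closure.
apply: (closure_mx_cvg (u := fun K => \matrix_(i < r - 1, k < l - 1)
    (power_total R (m K.+1) i (4 * (k + 2) * (i + 1)) /
     power_total R (m K.+1) i (4 * (i + 1)) ^+ (k + 2)))).
  by apply: nearW => K; apply: power_total_ratio_profile.
(* Since [p_1 = 1], the target is written as [p_(k+2) / p_1^(k+2)], a ratio unaffected by the
   scaling by [K]. *)
move=> i k; rewrite xM -[power_sum _ _]divr1 -(expr1n _ (k + 2)) -{1}(x1 i).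
under eq_cvg => p do rewrite mxE.
have := cvg_power_ratio (n := (k + 2)%N) _ (cvg_total i (k + 2)%N) (cvg_total i 1%N).
rewrite x1 oner_neq0 => /(_ isT); apply: cvg_trans; apply: near_eq_cvg.
apply: nearW => p; rewrite muln1 expr_div_n -exprM.
have s0 : p.+1%:R ^+ (4 * (i + 1) * (k + 2)) != 0 :> R.
  by rewrite expf_neq0 // pnatr_eq0.
by rewrite invf_div mulrA divfK // mulnAC.
Qed.

Theorem theorem3p10 (R : realType) (l r : nat)
    (hl : (2 <= l)%N) (hr : (2 <= r)%N) :
  necklace_profile R l r = profile_power (r - 1) (power_sum_profile R l).
Proof.
(* Moving the closure outside the product reduces the first inclusion to the generating sets; the
   second then follows because the necklace profile is closed. *)
rewrite /power_sum_profile -closure_profile_power; apply/seteqP; split.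
  apply: closureS => _ [G [hG ->]] i; exists #|G| => //.
  by apply: necklace_point_row; apply: hG; have := ltn_ord i; lia.
rewrite [X in _ `<=` X](_ : _ = closure (necklace_profile R l r)); last first.
  by rewrite -(closure_id _).1 //; apply: closed_closure.
by apply: closureS; apply: power_sum_points_profile => //; apply: ltnW.
Qed.
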